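(* Let $r,\omega\in\mathbb{N}\cup\{0\}$ and $\alpha,\beta\in\{0,\ldots,\omega\}$ with $\alpha<\beta$. Then there is a canonical isomorphism of $\mathcal{F}(M)$-algebras $$\mathrm{h}_{\alpha}\mathcal{T}^r_{\omega-\alpha}(M_A)\equiv\mathrm{h}_{\beta}\mathcal{T}^r_{\omega-\beta}(M_A)\times\mathrm{Ker}(\imath^{\beta})\times\cdots\times\mathrm{Ker}(\imath^{\alpha+2})\times\mathrm{Ker}(\imath^{\alpha+1}),$$ $$S_{\omega-\alpha}\equiv(S_{\omega-\beta},\Delta_{\omega-\beta+1},\ldots,\Delta_{\omega-\alpha-1},\Delta_{\omega-\alpha}).$$ Under it, the transitions between the levels $s=\omega-\alpha$ and $s=\omega-\beta$ are given as follows. The vertical derivatives act by $$S_{\omega-\beta}\overset{\dot\partial_\beta}{\longmapsto}(S_{\omega-\beta},0),\qquad(S_{\omega-\beta},\Delta_{\omega-\beta+1})\overset{\dot\partial_{\beta-1}}{\longmapsto}(S_{\omega-\beta},\Delta_{\omega-\beta+1},0),\quad\ldots,$$ $$(S_{\omega-\beta},\Delta_{\omega-\beta+1},\ldots,\Delta_{\omega-\alpha-1})\overset{\dot\partial_{\alpha+1}}{\longmapsto}(S_{\omega-\beta},\Delta_{\omega-\beta+1},\ldots,\Delta_{\omega-\alpha-1},0),$$ and the contractions with $\mathbb{C}$, successively composed, act by $$(S_{\omega-\beta},\ldots,\Delta_{\omega-\alpha-1},\Delta_{\omega-\alpha})\overset{\imath^{\alpha+1}}{\longmapsto}(\alpha+1)(S_{\omega-\beta},\ldots,\Delta_{\omega-\alpha-1})\overset{\imath^{\alpha+2}}{\longmapsto}\cdots$$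 $$\cdots\overset{\imath^{\beta-1}}{\longmapsto}\left(\prod_{\nu=\alpha+1}^{\beta-1}\nu\right)(S_{\omega-\beta},\Delta_{\omega-\beta+1})\overset{\imath^{\beta}}{\longmapsto}\left(\prod_{\nu=\alpha+1}^{\beta}\nu\right)S_{\omega-\beta}.$$
   Context: $M$ is a smooth (Hausdorff, second countable) $n$-dimensional manifold and $A\subseteq \mathrm{T}M\setminus\mathbf{0}$ is an open subset (where $\mathbf 0$ is the zero section) such that every fiber $A_p:=A\cap \mathrm{T}_pM$, $p\in M$, is nonempty and conic (closed under multiplication by $\lambda\in\mathbb{R}^+=(0,\infty)$). $\pi_A\colon A\to M$ is the natural projection. All objects are assumed to be smooth, where smooth means $\mathcal{C}^m$ with $m$ large enough that all the derivatives considered of anisotropic tensors exist and are continuous on $A$. $\mathcal{F}(M)$ is the ring of (smooth) functions on $M$. $\mathcal{T}^r_s(M_A)$ is the set of $A$-anisotropic tensors of type $(r,s)$, i.e. sections of $\pi_A^*(\mathrm{T}M^{\otimes r}\otimes \mathrm{T}^*M^{\otimes s})\to A$; in natural coordinates $(x^i,y^i)$ on $\mathrm{T}M$ they have components $T^{i_1\ldots i_r}_{j_1\ldots j_s}(x,y)$. $\mathrm{h}_\alpha\mathcal{T}^r_s(M_A)$ is the subset of $\alpha$-homogeneous ones: $T^{i_1\ldots i_r}_{j_1\ldots j_s}(x,\lambda y)=\lambda^\alpha T^{i_1\ldots i_r}_{j_1\ldots j_s}(x,y)$ for $\lambda\in\mathbb{R}^+$. $\mathbb{C}=y^i\partial_{x^i}$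 ($\mathbb{C}_v=v$) is the Liouville field. The vertical derivative is $(\dot\partial T)^{i_1\ldots i_r}_{j_1\ldots j_s k}=\partial T^{i_1\ldots i_r}_{j_1\ldots j_s}/\partial y^k$ and the contraction on the last covariant index is $(\imath_{\mathbb{C}}S)^{i_1\ldots i_r}_{j_1\ldots j_s}=S^{i_1\ldots i_r}_{j_1\ldots j_s a}y^a$. For $\nu\in\{1,\ldots,\omega\}$, write $\dot\partial_\nu:=\dot\partial\colon\mathrm{h}_{\nu}\mathcal{T}^r_{\omega-\nu}(M_A)\to\mathrm{h}_{\nu-1}\mathcal{T}^r_{\omega-\nu+1}(M_A)$ and $\imath^{\nu}:=\imath_{\mathbb{C}}\colon\mathrm{h}_{\nu-1}\mathcal{T}^r_{\omega-\nu+1}(M_A)\to\mathrm{h}_{\nu}\mathcal{T}^r_{\omega-\nu}(M_A)$. ''Level $s$'' refers to $\mathrm{h}_{\omega-s}\mathcal{T}^r_s(M_A)$. Subscripts on $S_s,\Delta_s$ indicate the level; thus $\Delta_{\omega-\nu+1}\in\mathrm{Ker}(\imath^\nu)\subset\mathrm{h}_{\nu-1}\mathcal{T}^r_{\omega-\nu+1}(M_A)$. ''Canonical'' isomorphism: the one obtained by iterating, from $\nu=\beta$ to $\nu=\alpha+1$, the unique decomposition $S_{\omega-\nu+1}=\dot\partial S_{\omega-\nu}+\Delta_{\omega-\nu+1}$ of elements of $\mathrm{h}_{\nu-1}\mathcal{T}^r_{\omega-\nu+1}(M_A)$, with $S_{\omega-\nu}\in \mathrm{h}_{\nu}\mathcal{T}^r_{\omega-\nu}(M_A)$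 and $\Delta_{\omega-\nu+1}\in\mathrm{Ker}(\imath^\nu)$; that is, the tuple $(S_{\omega-\beta},\Delta_{\omega-\beta+1},\ldots,\Delta_{\omega-\alpha})$ corresponds to $S_{\omega-\alpha}=\dot\partial^{\,\beta-\alpha}S_{\omega-\beta}+\sum_{\nu=\alpha+1}^{\beta}\dot\partial^{\,\nu-1-\alpha}\Delta_{\omega-\nu+1}$. For an intermediate level $\omega-\gamma$ with $\alpha<\gamma<\beta$ the identification used is the one with $\gamma$ in place of $\alpha$; level $\omega-\beta$ is identified with itself.
   Formalization: ''Isomorphism of F(M)-algebras'' is read as isomorphism of F(M)-modules, since tensors of one fixed type and degree carry no product; ''smooth'' is read as C^∞, since for a fixed finite m the vertical derivative leaves the class C^m. *)

(* Defs.v *)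
From HB Require Import structures.
From mathcomp Require Import all_boot all_order all_algebra.
From mathcomp Require Import all_classical all_reals all_analysis.
Import Order.TTheory GRing.Theory Num.Theory.
Import numFieldNormedType.Exports.

Set Implicit Arguments.
Unset Strict Implicit.
Unset Printing Implicit Defensive.

Local Open Scope classical_set_scope.
Local Open Scope ring_scope.

Section SmoothOn.
Variables (R : realType) (V W : normedModType R) (U : set V).

(* The usual class C^k when [U] is open and [V] is finite-dimensional. *)
Fixpoint Ck_on (k : nat) (f : V -> W) : Prop :=
  if k is k'.+1 then
    (forall x, U x -> differentiable f x) /\ (forall v, Ck_on k' ('D_v f))
  else forall x, U x -> {for x, continuous f}.

Definition smooth_on (f : V -> W) : Prop := forall k, Ck_on k f.

End SmoothOn.

Section SmoothTheory.
Context {R : realType}.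

Lemma near_differentiable (V W : normedModType R) (f g : V -> W) x :
  (\forall y \near x, f y = g y) -> differentiable f x -> differentiable g x.
Proof.
move=> fg df; have fgx : f x = g x by exact: nbhs_singleton fg.
have /diffP[dfc H] := df.
apply/diffP => /=.
apply: (@getPex _ (fun (dg : {linear V -> W}) => continuous dg /\
  forall y, g y = g (lim (nbhs x)) + dg (y - lim (nbhs x))
                  +o_(y \near x) (y - lim (nbhs x)))).
exists ('d f x); split => //.
have /eqaddoP H' : f = (fun y => f (lim (nbhs x)) + 'd f x (y - lim (nbhs x)))
    +o_x (fun y => y - lim (nbhs x)).
  by apply: eqaddoE; rewrite funeqE; exact: H.
suff : g = (fun y => g (lim (nbhs x)) + 'd f x (y - lim (nbhs x)))
    +o_x (fun y => y - lim (nbhs x)).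
  by move=> gE; apply: eqaddoEx => z; rewrite {1}gE.
apply/eqaddoP => e e0; have := H' e e0; rewrite lim_id// -fgx.
by move: fg; apply: filterS2 => y fgy; rewrite !fctE fgy.
Qed.

Section Open.
Variables (V W : normedModType R) (U : set V).
Hypothesis oU : open U.

Lemma Ck_on_ext k (f g : V -> W) :
  (forall x, U x -> f x = g x) -> Ck_on U k f -> Ck_on U k g.
Proof.
have nearfg (f' g' : V -> W) x : (forall y, U y -> f' y = g' y) -> U x ->
    \forall y \near x, f' y = g' y.
  by move=> fg Ux; apply: filterS fg _; exact: open_nbhs_nbhs.
elim: k f g => [|k IHk] f g fg /=.
  move=> fc x Ux; rewrite /prop_for /continuous_at -(fg x Ux).
  apply: cvg_trans (fc x Ux); apply: near_eq_cvg; exact: nearfg.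
move=> [df Df]; split=> [x Ux|v].
  by apply: near_differentiable (df x Ux); exact: nearfg.
apply: IHk (Df v) => x Ux; apply: near_eq_derive; exact: nearfg.
Qed.

Lemma Ck_onS k (f : V -> W) : Ck_on U k.+1 f -> Ck_on U k f.
Proof.
elim: k f => [|k IHk] f [df Df].
  by move=> x Ux; exact/differentiable_continuous/df.
by split=> // v; exact/IHk/Df.
Qed.

Lemma Ck_onD k (f g : V -> W) :
  Ck_on U k f -> Ck_on U k g -> Ck_on U k (f + g).
Proof.
elim: k f g => [|k IHk] f g /=.
  by move=> fc gc x Ux; exact: continuousD (fc x Ux) (gc x Ux).
move=> [df Df] [dg Dg]; split=> [x Ux|v].
  exact: differentiableD (df x Ux) (dg x Ux).
apply: (@Ck_on_ext _ ('D_v f + 'D_v g)); last exact: IHk.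
by move=> x Ux; rewrite deriveD//; apply: diff_derivable; [exact: df|exact: dg].
Qed.

Lemma Ck_on_cst k (w : W) : Ck_on U k (cst w : V -> W).
Proof.
elim: k w => [|k IHk] w /=; first by move=> x _; exact: cvg_cst.
split=> [x _|v]; first exact: differentiable_cst.
by apply: Ck_on_ext (IHk 0) => x _; rewrite derive_cst.
Qed.

End Open.

Lemma Ck_onM (V : normedModType R) (U : set V) (oU : open U) k (f g : V -> R) :
  Ck_on U k f -> Ck_on U k g -> Ck_on U k (f * g).
Proof.
elim: k f g => [|k IHk] f g fk gk.
  by move=> x Ux; exact: continuousM (fk x Ux) (gk x Ux).
have [df Df] := fk; have [dg Dg] := gk; split=> [x Ux|v].
  exact: differentiableM (df x Ux) (dg x Ux).
apply: (@Ck_on_ext _ _ _ oU _ (f * 'D_v g + g * 'D_v f)).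
  by move=> x Ux; rewrite deriveM//; apply: diff_derivable; [exact: df|exact: dg].
apply: Ck_onD => //; apply: IHk; by [exact: Ck_onS | exact: Df | exact: Dg].
Qed.

Lemma Ck_on_fst (V V' W : normedModType R) (U : set V) (U' : set (V * V'))
    k (f : V -> W) :
  (forall z, U' z -> U z.1) -> Ck_on U k f ->
  Ck_on U' k (fun z : V * V' => f z.1).
Proof.
move=> U'U; elim: k f => [|k IHk] f /=.
  move=> fc z U'z; apply: (@continuous_comp _ _ _ fst f z); first exact: cvg_fst.
  exact: fc (U'U _ U'z).
move=> [df Df]; split=> [z U'z|v]; last exact: IHk (Df v.1).
apply: (@differentiable_comp _ _ _ _ fst f z); last exact: df (U'U _ U'z).
apply: linear_differentiable => y; exact: cvg_fst.
Qed.

End SmoothTheory.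

Record chart (R : realType) (n : nat) (M : topologicalType) := Chart {
  cdom : set M;
  cmap :> M -> 'rV[R]_n;
  cinv : 'rV[R]_n -> M;
  cdom_open : open cdom;
  cimg_open : open (cmap @` cdom);
  cmapK : forall p, cdom p -> cinv (cmap p) = p;
  cmap_continuous : forall p, cdom p -> {for p, continuous cmap};
  cinv_continuous : forall x, (cmap @` cdom) x -> {for x, continuous cinv}
}.

Arguments cdom_open {R n M} c.
Arguments cimg_open {R n M} c.

Record smooth_manifold (R : realType) (n : nat) := SmoothManifold {
  carrier :> topologicalType;
  manifold_hausdorff : hausdorff_space carrier;
  manifold_second_countable : @second_countable carrier;
  cidx : Type;
  atlas : cidx -> chart R n carrier;
  atlas_cover : forall p, exists c, cdom (atlas c) p;
  atlas_smooth : forall c d, smooth_on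
    (atlas c @` (cdom (atlas c) `&` cdom (atlas d)))
    (atlas d \o cinv (atlas c))
}.
Arguments atlas {R n} s c.

Section Functions.
Context {R : realType} {n : nat} (M : smooth_manifold R n).

Definition smooth_fun_pred : {pred (M -> R)} := fun f =>
  `[< forall c, smooth_on (atlas M c @` cdom (atlas M c))
                          (f \o cinv (atlas M c)) >].

Lemma smooth_fun_subproof : GRing.subring_closed smooth_fun_pred.
Proof.
have o c := cimg_open (atlas M c).
have N1 c k : Ck_on (atlas M c @` cdom (atlas M c)) k (cst (- 1) : _ -> R).
  exact: Ck_on_cst.
split=> [|f g /asboolP fs /asboolP gs|f g /asboolP fs /asboolP gs].
- by apply/asboolP => c k; exact: Ck_on_cst.
- apply/asboolP => c k.
  apply: (@Ck_on_ext _ _ _ _ (o c) _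
    ((f \o cinv (atlas M c)) + cst (- 1) * (g \o cinv (atlas M c)))).
    by move=> x _; rewrite !fctE mulN1r.
  by apply: Ck_onD => //; [exact: fs | apply: Ck_onM => //; exact: gs].
- by apply/asboolP => c k; apply: Ck_onM; [exact: o|exact: fs|exact: gs].
Qed.

(* The ring F(M). *)
Record smooth_fun := SmoothFun {
  smooth_fun_val :> M -> R;
  smooth_fun_valP : smooth_fun_val \in smooth_fun_pred
}.
HB.instance Definition _ := [isSub for smooth_fun_val].
HB.instance Definition _ := [Choice of smooth_fun by <:].
HB.instance Definition _ :=
  GRing.SubChoice_isSubComPzRing.Build (M -> R) smooth_fun_pred smooth_fun
    smooth_fun_subproof.

End Functions.

Section TangentBundle.
Context {R : realType} {n : nat} (M : smooth_manifold R n).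

(* With row vectors, [jac c d p] has the entry dx_d^b / dx_c^a at row a and
   column b, where x_c and x_d are the coordinates of the charts c and d. *)
Definition jac (c d : cidx M) (p : M) : 'M[R]_n :=
  'J (atlas M d \o cinv (atlas M c)) (atlas M c p).

(* A tangent vector at p is the family of its components in all the charts
   around p, related by the Jacobians of the changes of coordinates; it takes
   the conventional value 0 in the other charts. *)
Definition tangent_pred (p : M) : {pred (cidx M -> 'rV[R]_n)} := fun v =>
  `[< (forall c, ~ cdom (atlas M c) p -> v c = 0) /\
      (forall c d, cdom (atlas M c) p -> cdom (atlas M d) p ->
         v d = v c *m jac c d p) >].

Lemma tangent_subproof p : GRing.submod_closed (tangent_pred p).
Proof.
split=> [|a u v /asboolP[u0 uJ] /asboolP[v0 vJ]]; apply/asboolP; split.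
- by [].
- by move=> c d _ _; rewrite mul0mx.
- by move=> c pc; rewrite !fctE u0// v0// scaler0 addr0.
- by move=> c d pc pd; rewrite !fctE (uJ c d)// (vJ c d)// mulmxDl scalemxAl.
Qed.
HB.instance Definition _ p := GRing.isSubmodClosed.Build R _ (tangent_pred p)
  (tangent_subproof p).

Record tangent (p : M) := Tangent {
  tangent_val :> cidx M -> 'rV[R]_n;
  tangent_valP : tangent_val \in tangent_pred p
}.
HB.instance Definition _ p := [isSub for @tangent_val p].
HB.instance Definition _ p := [Choice of tangent p by <:].
HB.instance Definition _ p := [SubChoice_isSubLmodule of tangent p by <:].

Definition TM := {p : M & tangent p}.

(* The natural coordinates (x, y) on TM. *)
Definition tcoord (c : cidx M) (v : TM) : 'rV[R]_n * 'rV[R]_n :=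
  (atlas M c (projT1 v), projT2 v c).

Definition tdom (c : cidx M) : set TM := [set v | cdom (atlas M c) (projT1 v)].

Definition TM_open (O : set TM) : Prop :=
  forall c, open (tcoord c @` (O `&` tdom c)).

(* Since the sets avoid the zero section and meet every fibre, there are none
   for n = 0 unless M is empty. *)
Record conic_domain := ConicDomain {
  cone_set : set TM;
  cone_open : TM_open cone_set;
  cone_nonzero : forall v, cone_set v -> projT2 v != 0;
  cone_nonempty : forall p, exists v : tangent p, cone_set (existT _ p v);
  cone_conic : forall p (v : tangent p) (l : R), 0 < l ->
    cone_set (existT _ p v) -> cone_set (existT _ p (l *: v))
}.

End TangentBundle.

Section AnisotropicTensors.
Context {R : realType} {n : nat} {M : smooth_manifold R n}.

(* [T c (x, y) i j] is the component with contravariant indices i and covariant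
   indices j, at the point of natural coordinates (x, y) in the chart c. The
   type does not depend on the valence (r, s), so that levels whose indices are
   only provably equal, like omega - (nu - 1) and omega - nu + 1, agree. *)
Definition components : Type :=
  cidx M -> 'rV[R]_n * 'rV[R]_n -> seq 'I_n -> seq 'I_n -> R.

HB.instance Definition _ := GRing.Zmodule.copy components
  (cidx M -> 'rV[R]_n * 'rV[R]_n -> seq 'I_n -> seq 'I_n -> R).

Definition fscale (f : smooth_fun M) (T : components) : components :=
  fun c z i j => f (cinv (atlas M c) z.1) * T c z i j.

Fact fscaleA f g T : fscale f (fscale g T) = fscale (f * g) T.
Proof. by do 4 apply/funext => ?; rewrite /fscale mulrA. Qed.
Fact fscale1 : left_id 1 fscale.
Proof. by move=> T; do 4 apply/funext => ?; rewrite /fscale mul1r. Qed.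
Fact fscaleDr : right_distributive fscale +%R.
Proof. by move=> f S T; do 4 apply/funext => ?; rewrite /fscale mulrDr. Qed.
Fact fscaleDl T : {morph fscale^~ T : f g / f + g}.
Proof. by move=> f g; do 4 apply/funext => ?; rewrite /fscale mulrDl. Qed.
HB.instance Definition _ := GRing.Zmodule_isLmodule.Build (smooth_fun M)
  components fscaleA fscale1 fscaleDr fscaleDl.

Variable A : conic_domain M.

Definition cone_coord (c : cidx M) : set ('rV[R]_n * 'rV[R]_n) :=
  tcoord c @` (cone_set A `&` tdom c).

(* The component families of the A-anisotropic tensors of type (r, s), extended
   by 0 to the indices of the wrong length and to the points out of A. *)
Definition anisotropic (r s : nat) (T : components) : Prop :=
  [/\ forall c z i j, ~ [/\ cone_coord c z, size i = r & size j = s] ->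
        T c z i j = 0,
      forall c i j, smooth_on (cone_coord c) (fun z => T c z i j) &
      forall v : TM M, cone_set A v -> forall c d, tdom c v -> tdom d v ->
        forall (i' : r.-tuple 'I_n) (j' : s.-tuple 'I_n),
        T d (tcoord d v) i' j' =
          \sum_(i : r.-tuple 'I_n) \sum_(j : s.-tuple 'I_n)
            (\prod_(m < r) jac c d (projT1 v) (tnth i m) (tnth i' m)) *
            (\prod_(m < s) jac d c (projT1 v) (tnth j' m) (tnth j m)) *
            T c (tcoord c v) i j].

Definition homogeneous (a : nat) (T : components) : Prop :=
  forall c z, cone_coord c z -> forall l : R, 0 < l -> forall i j,
    T c (z.1, l *: z.2) i j = l ^+ a * T c z i j.

(* The derivative index comes last. *)
Definition vdiff (T : components) : components := fun c z i j =>
  if j is k :: j' then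
    if `[< cone_coord c z >] then
      'D_(0, delta_mx 0 (last k j'))
         (fun w : 'rV[R]_n * 'rV[R]_n => T c w i (belast k j')) z
    else 0
  else 0.

Definition contrC (S : components) : components := fun c z i j =>
  \sum_(a < n) S c z i (rcons j a) * z.2 0 a.

Definition htensor_pred (a r s : nat) : {pred components} :=
  fun T => `[< anisotropic r s T /\ homogeneous a T >].

Definition ckernel_pred (a r s : nat) : {pred components} :=
  fun S => (S \in htensor_pred a r s) && (contrC S == 0).

Lemma cone_coord_open c : open (cone_coord c).
Proof. exact: cone_open. Qed.

Lemma htensor_subproof a r s : GRing.submod_closed (htensor_pred a r s).
Proof.
split=> [|f T U /asboolP[[T0 Ts TJ] Th] /asboolP[[U0 Us UJ] Uh]].
  apply/asboolP; split; last by move=> c z _ l _ i j; rewrite mulr0.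
  split=> [//|c i j k|v Av c d vc vd i' j'].
    exact: (@Ck_on_cst _ _ _ _ (@cone_coord_open c) k 0).
  by rewrite big1// => i _; rewrite big1// => j _; rewrite mulr0.
have cinvK c (v : TM M) : tdom c v ->
  cinv (atlas M c) (tcoord c v).1 = projT1 v by exact: cmapK.
apply/asboolP; split; last first.
  move=> c z cz l l0 i j; rewrite !fctE /GRing.scale/= /fscale/=.
  by rewrite Th// Uh// mulrDr mulrCA.
split=> [c z i j nP|c i j k|v Av c d vc vd i' j'].
- by rewrite !fctE /GRing.scale/= /fscale T0// U0// mulr0 addr0.
- have oA := @cone_coord_open c.
  apply: (@Ck_on_ext _ _ _ _ oA _ (((fun z => f (cinv (atlas M c) z.1)) *
    (fun z => T c z i j)) + (fun z => U c z i j))); first by [].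
  apply: Ck_onD => //; last exact: Us.
  apply: Ck_onM => //; last exact: Ts.
  have /asboolP fs := smooth_fun_valP f.
  apply: Ck_on_fst (fs c k) => _ [v [Av vc] <-].
  by exists (projT1 v).
- rewrite !fctE /GRing.scale/= /fscale (TJ _ Av c d)// (UJ _ Av c d)//.
  rewrite !cinvK// mulr_sumr -big_split/=; apply: eq_bigr => i _.
  rewrite mulr_sumr -big_split/=; apply: eq_bigr => j _.
  by rewrite mulrDr mulrCA.
Qed.
HB.instance Definition _ a r s :=
  GRing.isSubmodClosed.Build (smooth_fun M) components (htensor_pred a r s)
    (htensor_subproof a r s).

Lemma ckernel_subproof a r s : GRing.submod_closed (ckernel_pred a r s).
Proof.
split=> [|f T U /andP[Th /eqP T0] /andP[Uh /eqP U0]]; apply/andP; split.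
- exact: rpred0.
- apply/eqP; do 4 apply/funext => ?.
  by rewrite /contrC big1// => ? _; rewrite mul0r.
- by rewrite rpredD// rpredZ.
- apply/eqP; apply/funext => c; apply/funext => z; apply/funext => i.
  apply/funext => j; transitivity (f (cinv (atlas M c) z.1) *
      contrC T c z i j + contrC U c z i j).
    rewrite /contrC mulr_sumr -big_split/=; apply: eq_bigr => b _.
    by rewrite !fctE mulrDl mulrA.
  by rewrite T0 U0 mulr0 addr0.
Qed.
HB.instance Definition _ a r s :=
  GRing.isSubmodClosed.Build (smooth_fun M) components (ckernel_pred a r s)
    (ckernel_subproof a r s).

(* h_a T^r_s(M_A) *)
Record htensor (a r s : nat) := HTensor {
  htensor_val : components;
  htensor_valP : htensor_val \in htensor_pred a r s
}.
HB.instance Definition _ a r s := [isSub for @htensor_val a r s].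
HB.instance Definition _ a r s := [Choice of htensor a r s by <:].
HB.instance Definition _ a r s := [SubChoice_isSubLmodule of htensor a r s by <:].

(* The kernel of the contraction in h_a T^r_s(M_A) *)
Record ckernel (a r s : nat) := CKernel {
  ckernel_val : components;
  ckernel_valP : ckernel_val \in ckernel_pred a r s
}.
HB.instance Definition _ a r s := [isSub for @ckernel_val a r s].
HB.instance Definition _ a r s := [Choice of ckernel a r s by <:].
HB.instance Definition _ a r s := [SubChoice_isSubLmodule of ckernel a r s by <:].

Section Levels.
Variables r omega beta : nat.

(* Ker(i^nu) *)
Definition Ker (nu : nat) : lmodType (smooth_fun M) :=
  ckernel nu.-1 r (omega - nu).+1.

(* h_beta T^r_(omega - beta) x Ker(i^beta) x .. x Ker(i^(beta - k + 1)), that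
   is, the tuples at the level omega - beta + k *)
Fixpoint tuples (k : nat) : lmodType (smooth_fun M) :=
  if k is k'.+1 then (tuples k' * Ker (beta - k'))%type
  else htensor beta r (omega - beta).

(* The component family identified with a tuple, obtained by iterating
   S' = vdiff S + Delta, from the leftmost entry on; it is a tensor of degree
   beta - k at the level omega - beta + k. *)
Fixpoint assemble (k : nat) : tuples k -> components :=
  match k return tuples k -> components with
  | 0 => fun S : htensor _ _ _ => htensor_val S
  | k'.+1 => fun t : tuples k' * ckernel _ _ _ =>
      vdiff (assemble t.1) + ckernel_val t.2
  end.

(* The projection that forgets the last j entries. *)
Fixpoint truncate (j k : nat) : tuples (j + k) -> tuples k :=
  match j return tuples (j + k) -> tuples k with
  | 0 => fun t => t
  | j'.+1 => fun t : tuples (j' + k) * ckernel _ _ _ => truncate t.1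
  end.

End Levels.
End AnisotropicTensors.

(* Main.v *)
(* By Euler's theorem, contracting the vertical derivative of a nu-homogeneous
   tensor with the Liouville field multiplies it by nu. So for nu >= 1 a tensor
   S in the target of the vertical derivative has the unique decomposition
   S = vdiff S' + Delta with contrC Delta = 0, where S' = nu^-1 contrC S;
   iterating it from the level omega - beta on inverts [assemble]. Since
   contrC (vdiff S' + Delta) = nu S', each contraction forgets the last entry
   and multiplies by nu. *)
From HB Require Import structures.
Require Import Defs.
From mathcomp Require Import all_boot all_order all_algebra.
From mathcomp Require Import all_classical all_reals all_analysis.
From mathcomp Require Import zify.
Import Order.TTheory GRing.Theory Num.Theory.
Import numFieldNormedType.Exports.

Set Implicit Arguments.
Unset Strict Implicit.
Unset Printing Implicit Defensive.

Local Open Scope classical_set_scope.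
Local Open Scope ring_scope.

(** * Directional derivatives along lines *)

Section DerivativeAlongLines.
Context {R : realType} {V V' W : normedModType R}.

(** The difference quotients see only values on a line near its base point. The two lines may lie in
    different spaces: this serves to change charts, to rescale a fibre, and to compare a ray with
    [R]. *)
Lemma derive_line (f : V -> W) (g : V' -> W) (x v : V) (y w : V') :
  (\forall h \near (0 : R), f (h *: v + x) = g (h *: w + y)) ->
  'D_v f x = 'D_w g y.
Proof.
move=> fg; have fgx : f x = g y.
  by have := nbhs_singleton fg; rewrite !scale0r !add0r.
have E : \forall h \near (0 : R)^', h^-1 *: ((f \o shift x) (h *: v) - f x) =
    h^-1 *: ((g \o shift y) (h *: w) - g y).
  by apply: cvg_within; apply: filterS fg => h /= ->; rewrite fgx.
(* [lim] depends only on the image filter, and eventually equal quotients have the same one,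
   convergent or not. *)
rewrite /derive; congr (lim _).
rewrite eqEsubset; split; apply: near_eq_cvg => //.
by apply: filterS E => h ->.
Qed.

Lemma near_line (U : set V) (x v : V) :
  open U -> U x -> \forall h \near (0 : R), U (h *: v + x).
Proof.
move=> oU Ux; have /= : (fun h : R => h *: v + x) @ (0 : R) --> 0 *: v + x.
  by apply: cvgD; [apply: cvgZr_tmp; exact: cvg_id | exact: cvg_cst].
by rewrite scale0r add0r; apply; exact: open_nbhs_nbhs.
Qed.

End DerivativeAlongLines.

(** * Multi-indices with the last index split off *)

Section RconsTuples.
Context {T : finType} {s : nat}.

Lemma rcons_tuple_bij :
  bijective (fun p : s.-tuple T * T => [tuple of rcons p.1 p.2]).
Proof.
apply: inj_card_bij => [[t a] [u b] /(congr1 val)/= /rcons_inj[tu ->]|].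
  by congr pair; apply: val_inj.
by rewrite card_prod !card_tuple expnSr.
Qed.

Lemma tuple_rcons (t : s.+1.-tuple T) :
  exists (u : s.-tuple T) (a : T), t = [tuple of rcons u a].
Proof.
by have [g _ gK] := rcons_tuple_bij; exists (g t).1, (g t).2; rewrite -[LHS]gK.
Qed.

Lemma big_tuple_rcons (S : nmodType) (F : s.+1.-tuple T -> S) :
  \sum_t F t = \sum_(u : s.-tuple T) \sum_(a : T) F [tuple of rcons u a].
Proof.
rewrite pair_big/= (reindex _ (onW_bij _ rcons_tuple_bij)).
by apply: eq_bigr => p _; congr F; apply: val_inj.
Qed.

(** With [F] a Jacobian, this isolates the factor of the last covariant index, the one that [vdiff]
    creates and [contrC] sums away. *)
Lemma big_ord_rcons (S : pzSemiRingType) (F : T -> T -> S) (t u : s.-tuple T)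
    (a b : T) :
  \prod_(m < s.+1) F (tnth [tuple of rcons t a] m) (tnth [tuple of rcons u b] m) =
  (\prod_(m < s) F (tnth t m) (tnth u m)) * F a b.
Proof.
have lst (v : s.-tuple T) c : tnth [tuple of rcons v c] ord_max = c.
  by rewrite (tnth_nth c)/= nth_rcons size_tuple ltnn eqxx.
have ini (v : s.-tuple T) c m :
    tnth [tuple of rcons v c] (widen_ord (leqnSn s) m) = tnth v m.
  by rewrite !(tnth_nth c)/= nth_rcons size_tuple ltn_ord.
rewrite big_ord_recr/= !lst; congr (_ * _).
by apply: eq_bigr => m _; rewrite !ini.
Qed.

End RconsTuples.

(** * Differential calculus of finite sums and linear maps *)

Section DifferentiableSum.
Context {R : realType} {V W : normedModType R} {I : Type}.

Lemma differentiable_big (s : seq I) (F : I -> V -> W) x :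
  (forall i, differentiable (F i) x) -> differentiable (\sum_(i <- s) F i) x.
Proof.
move=> dF; elim: s => [|i s IHs].
  by rewrite big_nil; exact: (differentiable_cst (0 : W)).
by rewrite big_cons; exact: differentiableD.
Qed.

Lemma derive_big (s : seq I) (F : I -> V -> W) x v :
  (forall i, differentiable (F i) x) ->
  'D_v (\sum_(i <- s) F i) x = \sum_(i <- s) 'D_v (F i) x.
Proof.
move=> dF; elim: s => [|i s IHs].
  by rewrite !big_nil; exact: (derive_cst (0 : W)).
rewrite !big_cons deriveD ?IHs//; apply: diff_derivable => //.
exact: differentiable_big.
Qed.

End DifferentiableSum.

Section SmoothExtra.
Context {R : realType} {V W : normedModType R} (U : set V).
Hypothesis oU : open U.

Lemma Ck_on_sum k (I : Type) (s : seq I) (F : I -> V -> W) :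
  (forall i, Ck_on U k (F i)) -> Ck_on U k (\sum_(i <- s) F i).
Proof.
move=> FP; elim: s => [|i s IHs].
  by rewrite big_nil; exact: (@Ck_on_cst _ _ _ _ oU k 0).
by rewrite big_cons; apply: Ck_onD.
Qed.

Lemma Ck_on_linear k (f : {linear V -> W}) :
  continuous (f : V -> W) -> Ck_on U k f.
Proof.
move=> fc; case: k => [|k] /=; first by move=> x _; exact: fc.
have df x : differentiable f x by exact: linear_differentiable.
split=> [x _|v]; first exact: df.
apply: (@Ck_on_ext _ _ _ _ oU k (cst (f v))); last exact: Ck_on_cst.
by move=> x _; rewrite deriveE// diff_lin.
Qed.

End SmoothExtra.

(** * Derivatives in the fibre directions *)

Section Fibre.
Context {R : realType} {n : nat} {V : normedModType R}.
Implicit Types (f : V * 'rV[R]_n -> R) (z : V * 'rV[R]_n).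

Definition fcoord (a : 'I_n) z : R := z.2 0 a.

Fact fcoord_linear a : linear (fcoord a).
Proof. by move=> l u v; rewrite /fcoord/= !mxE. Qed.
HB.instance Definition _ a :=
  GRing.isLinear.Build R (V * 'rV[R]_n)%type R *%R (fcoord a) (fcoord_linear a).

Lemma fcoord_continuous a : continuous (fcoord a).
Proof.
move=> z; apply: (@continuous_comp _ _ _ snd (fun w : 'rV[R]_n => w 0 a)).
  exact: cvg_snd.
exact: coord_continuous.
Qed.

(** Differentiability, and not only the existence of partial derivatives, makes the derivative
    linear in its direction. *)
Lemma derive_fibre f z (w : 'rV[R]_n) : differentiable f z ->
  'D_(0, w) f z = \sum_a w 0 a * 'D_(0, delta_mx 0 a) f z.
Proof.
move=> df; have -> : (0 : V, w) = \sum_a w 0 a *: (0, delta_mx 0 a).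
  rewrite {1}[w]row_sum_delta.
  rewrite (big_morph (fun u : 'rV[R]_n => (0 : V, u)) (id1 := 0) (op1 := +%R))//.
    by apply: eq_bigr => a _; congr pair; rewrite scaler0.
  by move=> u v; congr pair; rewrite addr0.
rewrite deriveE// linear_sum; apply: eq_bigr => a _.
by rewrite linearZ deriveE.
Qed.

End Fibre.

(** * The conic domain in natural coordinates *)

Section Cone.
Context {R : realType} {n : nat} {M : smooth_manifold R n} (A : conic_domain M).
Implicit Types (c d : cidx M) (z : 'rV[R]_n * 'rV[R]_n).

Lemma cone_coord_scale c z (l : R) :
  0 < l -> cone_coord A c z -> cone_coord A c (z.1, l *: z.2).
Proof.
move=> l0 [[p v] [Av vc] <-]; exists (existT _ p (l *: v)) => //.
by split=> //; exact: cone_conic.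
Qed.

Lemma tcoord_transition c d (v : TM M) : tdom c v -> tdom d v ->
  (tcoord d v).2 = (tcoord c v).2 *m jac c d (projT1 v).
Proof.
case: v => p v vc vd /=; have /asboolP[_] := tangent_valP v.
by apply.
Qed.

(** A chart is injective on its domain, so equal base coordinates force equal base points. *)
Lemma cone_fibre d (p : M) (w : 'rV[R]_n) : cdom (atlas M d) p ->
  cone_coord A d (atlas M d p, w) ->
  exists2 v : tangent p, cone_set A (existT _ p v) & v d = w.
Proof.
move=> pd [[q v] [Av /= vd]] [/= qp vw].
have qpE : q = p by have := cmapK vd; rewrite /= qp (cmapK pd).
by subst q; exists v.
Qed.

End Cone.

(** * Vertical derivative and contraction between levels *)

Section Levels.
Context {R : realType} {n : nat} {M : smooth_manifold R n} (A : conic_domain M).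
Implicit Types (c d : cidx M) (z : 'rV[R]_n * 'rV[R]_n) (T S : @components _ _ M).

Lemma htensorP (a r s : nat) T : reflect (anisotropic A r s T /\ homogeneous A a T)
  (T \in htensor_pred A a r s).
Proof. exact: asboolP. Qed.

Lemma vdiff_rcons T c z i j k : vdiff A T c z i (rcons j k) =
  if `[< cone_coord A c z >] then 'D_(0, delta_mx 0 k) (fun w => T c w i j) z
  else 0.
Proof. by case: j => [|a j] //=; rewrite last_rcons belast_rcons. Qed.

Lemma anisotropic_diff r s T c z i j : anisotropic A r s T -> cone_coord A c z ->
  differentiable (fun w => T c w i j) z.
Proof. by case=> _ Ts _ cz; have [+ _] := Ts c i j 1%N; apply. Qed.

Lemma anisotropic_vdiff r s T :
  anisotropic A r s T -> anisotropic A r s.+1 (vdiff A T).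
Proof.
move=> TP; have [T0 Ts TJ] := TP; split.
- move=> c z i j; case/lastP: j => [//|j k].
  rewrite vdiff_rcons size_rcons => nP; case: asboolP => // cz.
  (* On the cone, the failure comes from the length of [i] or [j]; the component differentiated is
     then identically 0. *)
  rewrite (_ : (fun w => _) = cst 0) ?derive_cst//.
  by apply/funext => w; apply: T0 => -[_ ir js]; apply: nP; rewrite js.
- move=> c i j; case/lastP: j => [|j k] m.
    exact: (@Ck_on_cst _ _ _ _ (@cone_coord_open _ _ _ A c) m 0).
  apply: Ck_on_ext ((Ts c i j m.+1).2 (0, delta_mx 0 k)).
    exact: cone_coord_open.
  by move=> z cz; rewrite vdiff_rcons; case: asboolP.
move=> v Av c d vc vd i' j'.
have [u' [k ->]] := tuple_rcons j'.
have cvc : cone_coord A c (tcoord c v) by exists v.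
have cvd : cone_coord A d (tcoord d v) by exists v.
pose J := jac d c (projT1 v).
pose C (i : r.-tuple 'I_n) (u : s.-tuple 'I_n) :=
  (\prod_(m < r) jac c d (projT1 v) (tnth i m) (tnth i' m)) *
  (\prod_(m < s) J (tnth u' m) (tnth u m)).
rewrite /= vdiff_rcons asboolT//.
(* The points of A near v on the line v + h e_k of its fibre have the same
   base point, so the transformation law holds there with the same Jacobians;
   derive it in h. *)
rewrite (@derive_line _ _ _ _ _ (\sum_(i : r.-tuple 'I_n) \sum_(u : s.-tuple 'I_n)
    (C i u *: fun w => T c w i u)) _ _ (tcoord c v) (0, delta_mx 0 k *m J)); last first.
  apply: filterS (near_line (0, delta_mx 0 k) (@cone_coord_open _ _ _ A d) cvd).
  move=> h; case: v Av vc vd cvc cvd @J @C => p v Av vc vd cvc cvd J C.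
  rewrite /tcoord/=.
  rewrite -[h *: _ + _]/(h *: 0 + _, h *: _ + v d) scaler0 add0r.
  move=> /(cone_fibre vd)[w Aw wd].
  rewrite -wd (TJ (existT _ p w) Aw c d)//.
  rewrite fct_sumE; apply: eq_bigr => i _.
  rewrite fct_sumE; apply: eq_bigr => u _.
  congr (_ * T c _ i u); rewrite /tcoord/=.
  have := tcoord_transition (v := existT _ p w) vd vc; rewrite /= => ->.
  have := tcoord_transition (v := existT _ p v) vd vc; rewrite /= => ->.
  rewrite wd mulmxDl -scalemxAl.
  by congr pair; rewrite /= scaler0 add0r.
have dT i u : differentiable (fun w => T c w i u) (tcoord c v).
  exact: anisotropic_diff TP cvc.
have dCT i u : differentiable (C i u *: (fun w => T c w i u)) (tcoord c v).
  exact: differentiableZ.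
rewrite derive_big; last by move=> i; exact: differentiable_big.
apply: eq_bigr => i _; rewrite derive_big//.
rewrite big_tuple_rcons; apply: eq_bigr => u _.
rewrite deriveZ; last exact: diff_derivable.
(* The direction [delta_mx 0 k *m J] is row [k] of [J]; its entries are the Jacobian factors of the
   new last index. *)
rewrite derive_fibre// scaler_sumr; apply: eq_bigr => a _.
rewrite (big_ord_rcons J) vdiff_rcons asboolT// -rowE mxE.
by rewrite [LHS]mulrA /C mulrA.
Qed.

(** Scaling by [l] carries the line through y in direction [l^-1] e_k to the line through [l] y in
    direction e_k. The degree contributes [l ^+ a.+1] and the direction [l^-1]. *)
Lemma homogeneous_vdiff r s a T :
  anisotropic A r s T -> homogeneous A a.+1 T -> homogeneous A a (vdiff A T).
Proof.
move=> TP Th c z cz l l0 i j; case/lastP: j => [|j k]; first by rewrite mulr0.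
have cz' := cone_coord_scale l0 cz.
rewrite !vdiff_rcons !asboolT//.
have dT := anisotropic_diff i j TP cz.
have l_neq0 : l != 0 by rewrite gt_eqF.
rewrite (@derive_line _ _ _ _ _ (l ^+ a.+1 \*: (fun w => T c w i j)) _ _ z
    (l^-1 *: (0, delta_mx 0 k))).
  rewrite deriveZ; last exact: diff_derivable.
  rewrite !deriveE// linearZ; apply: etrans (mulrA _ _ _) _.
  by rewrite exprSr mulfK.
have nl := near_line (l^-1 *: (0, delta_mx 0 k)) (@cone_coord_open _ _ _ A c) cz.
apply: filterS nl => h cwh; rewrite -[RHS](Th c _ cwh l l0 i j).
congr (T c _ i j); congr pair; rewrite /= ?scaler0// scalerDr; congr (_ + _).
by rewrite !scalerA mulrAC divff// mul1r.
Qed.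

(** On the line y + h y, that is (1 + h) y, homogeneity turns the component into a multiple of t^a
    at t = 1 + h, which is positive near h = 0. *)
Lemma euler r s a T c z i j : T \in htensor_pred A a r s ->
  cone_coord A c z -> 'D_(0, z.2) (fun w => T c w i j) z = a%:R * T c z i j.
Proof.
move=> /htensorP[TP Th] cz.
rewrite (@derive_line _ _ _ _ _ ((T c z i j) \*: (fun t : R => t ^+ a)) _ _ 1 1).
  rewrite deriveZ ?exp_derive.
    by rewrite expr1n !scaler1 /= mulrC.
  exact: exprn_derivable.
have h0 : \forall h \near (0 : R), 0 < h *: (1 : R) + 1.
  by apply: (@near_line _ _ [set t : R | 0 < t]) => //=; exact: open_gt.
apply: filterS h0 => h h0.
rewrite [RHS]mulrC -[RHS](Th c z cz _ h0 i j); congr (T c _ i j).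
by congr pair; rewrite /= ?scaler0 ?add0r// scalerDl -scalerA !scale1r.
Qed.

Lemma contrC_vdiff r s a T : T \in htensor_pred A a r s ->
  contrC (vdiff A T) = T *+ a.
Proof.
move=> Th; have /htensorP[TP _] := Th; have [T0 _ _] := TP.
apply/funext => c; apply/funext => z; apply/funext => i; apply/funext => j.
rewrite /contrC; under eq_bigr => b _ do rewrite vdiff_rcons.
have -> : (T *+ a) c z i j = a%:R * T c z i j.
  elim: a {Th} => [|a IHa]; rewrite ?mul0r//.
  by rewrite (mulrS 1) mulrDl mul1r -IHa mulrS.
case: asboolP => cz.
  rewrite -(euler _ _ Th cz) derive_fibre; last exact: anisotropic_diff TP cz.
  by apply: eq_bigr => b _; rewrite mulrC.
(* Off the cone both sides vanish, by the extension by 0. *)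
rewrite big1 => [|b _]; last by rewrite mul0r.
by rewrite T0 ?mulr0// => -[].
Qed.

(** The fibre coordinates pass from chart d to chart c by [jac d c], the very matrix attached to the
    last covariant index, so the two sums combine. *)
Lemma anisotropic_contrC r s S :
  anisotropic A r s.+1 S -> anisotropic A r s (contrC S).
Proof.
move=> [S0 Ss SJ]; split.
- move=> c z i j nP; rewrite /contrC big1// => b _.
  rewrite S0 ?mul0r// size_rcons => -[cz ir [js]]; exact: nP.
- move=> c i j k; have oA := @cone_coord_open _ _ _ A c.
  apply: (@Ck_on_ext _ _ _ _ oA k
    (\sum_(b < n) (fun z => S c z i (rcons j b)) * fcoord b)).
    by move=> z _; rewrite fct_sumE; apply: eq_bigr.
  apply: Ck_on_sum => // b; apply: Ck_onM => //; first exact: Ss.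
  by apply: Ck_on_linear => //; exact: fcoord_continuous.
move=> v Av c d vc vd i' j'; rewrite /contrC.
under eq_bigr => b _ do rewrite (SJ v Av c d vc vd i' [tuple of rcons j' b]).
under eq_bigr => b _ do rewrite mulr_suml.
rewrite exchange_big; apply: eq_bigr => i _ /=.
under eq_bigr => b _ do rewrite big_tuple_rcons mulr_suml.
rewrite exchange_big; apply: eq_bigr => u _ /=.
rewrite mulr_sumr; under eq_bigr => b _ do rewrite mulr_suml.
rewrite exchange_big; apply: eq_bigr => b _ /=.
have -> : projT2 v c = projT2 v d *m jac d c (projT1 v).
  exact: tcoord_transition.
rewrite mxE !mulr_sumr; apply: eq_bigr => b' _.
rewrite (big_ord_rcons (jac d c (projT1 v))).
by rewrite -!mulrA; do 2 congr (_ * _); rewrite mulrCA [in LHS](mulrC (jac _ _ _ _ _)).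
Qed.

Lemma homogeneous_contrC a S : homogeneous A a S -> homogeneous A a.+1 (contrC S).
Proof.
move=> Sh c z cz l l0 i j; rewrite /contrC mulr_sumr; apply: eq_bigr => b _.
by rewrite Sh// mxE exprSr; rewrite -!mulrA; congr (_ * _); rewrite mulrCA.
Qed.

Lemma contrC_is_linear : linear (@contrC _ _ M).
Proof.
move=> f S T.
apply/funext => c; apply/funext => z; apply/funext => i; apply/funext => j.
transitivity (f (cinv (atlas M c) z.1) * contrC S c z i j + contrC T c z i j)=> //.
rewrite /contrC mulr_sumr -big_split/=; apply: eq_bigr => b _.
by rewrite !fctE mulrDl mulrA.
Qed.

(** A function on M is constant along the fibres, so it acts as a scalar [l] under a vertical
    derivative. *)
Lemma vdiff_linear r s f S T : anisotropic A r s S -> anisotropic A r s T ->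
  vdiff A (f *: S + T) = f *: vdiff A S + vdiff A T.
Proof.
move=> SP TP.
apply/funext => c; apply/funext => z; apply/funext => i; apply/funext => j.
transitivity (f (cinv (atlas M c) z.1) * vdiff A S c z i j + vdiff A T c z i j)=> //.
case/lastP: j => [|j k]; first by rewrite mulr0 addr0.
rewrite !vdiff_rcons; case: asboolP => cz; last by rewrite mulr0 addr0.
pose l := f (cinv (atlas M c) z.1).
have dS := anisotropic_diff i j SP cz; have dT := anisotropic_diff i j TP cz.
rewrite (@derive_line _ _ _ _ _
    (l \*: (fun w => S c w i j) + (fun w => T c w i j)) _ _ z (0, delta_mx 0 k)).
  rewrite deriveD; [|apply: diff_derivable..] => //; last exact: differentiableZ.
  by rewrite deriveZ//; apply: diff_derivable.
apply: filterE => h; congr (f _ * _ + _); rewrite /l /=.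
by rewrite scaler0 add0r.
Qed.

Lemma htensor_vdiff a r s T :
  T \in htensor_pred A a.+1 r s -> vdiff A T \in htensor_pred A a r s.+1.
Proof.
move=> /htensorP[TP Th]; apply/htensorP; split; first exact: anisotropic_vdiff.
exact: homogeneous_vdiff TP Th.
Qed.

Lemma htensor_contrC a r s S :
  S \in htensor_pred A a r s.+1 -> contrC S \in htensor_pred A a.+1 r s.
Proof.
move=> /htensorP[SP Sh]; apply/htensorP; split; first exact: anisotropic_contrC.
exact: homogeneous_contrC.
Qed.

(** The scalars are functions on M, so dividing by a positive integer means scaling by a constant
    function. *)
Lemma const_smooth_fun (l : R) :
  (cst l : M -> R) \in smooth_fun_pred (M := M).
Proof. by apply/asboolP => c k; apply: Ck_on_cst; exact: cimg_open. Qed.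

Lemma const_smooth_fun_mulrn (m : nat) T : (0 < m)%N ->
  (SmoothFun (const_smooth_fun m%:R^-1) *: T) *+ m = T.
Proof.
move=> m0; rewrite -scaler_nat scalerA.
rewrite (_ : _ * _ = 1) ?scale1r//; apply: val_inj; apply/funext => p.
have mE : smooth_fun_val (m%:R : smooth_fun M) p = m%:R.
  by elim: m {m0} => [//|m IHm]; rewrite !mulrS -IHm.
rewrite -[LHS]/(smooth_fun_val (m%:R : smooth_fun M) p * m%:R^-1) mE.
by rewrite divff// pnatr_eq0 -lt0n.
Qed.

Lemma components_mulrIn (m : nat) : (0 < m)%N ->
  injective (fun T : @components _ _ M => T *+ m).
Proof.
move=> m0 S T /= ST.
by rewrite -(const_smooth_fun_mulrn S m0) -(const_smooth_fun_mulrn T m0)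
  !scalerMnr ST.
Qed.

(** * The iterated decomposition *)

Section Tuples.
Variables (r omega beta : nat).
Hypothesis le_beta_omega : (beta <= omega)%N.
Local Notation tuples := (tuples A r omega beta).

Let degree_succ k : (k < beta)%N -> (beta - k = (beta - k.+1).+1)%N.
Proof. by move=> kb; rewrite subnSK. Qed.

(** The truncated subtractions are exact because k < beta <= omega. *)
Let level_succ k : (k < beta)%N -> (omega - (beta - k.+1) = (omega - (beta - k)).+1)%N.
Proof. by move=> kb; rewrite (degree_succ kb) subnSK// -degree_succ//; lia. Qed.

Lemma assemble_htensor k (t : tuples k) : (k <= beta)%N ->
  assemble t \in htensor_pred A (beta - k) r (omega - (beta - k)).
Proof.
elim: k t => [|k IHk] t kb; first by rewrite subn0; exact: htensor_valP.
rewrite level_succ// /= rpredD//.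
  by apply: htensor_vdiff; rewrite -degree_succ//; apply: IHk; exact: ltnW.
by have /andP[+ _] := ckernel_valP t.2; rewrite subnS.
Qed.

Lemma assemble_linear k f (t u : tuples k) : (k <= beta)%N ->
  assemble (f *: t + u) = f *: assemble t + assemble u.
Proof.
elim: k t u => [//|k IHk] t u kb.
case: t u => [t D] [u E] /=.
have aP (v : tuples k) : anisotropic A r (omega - (beta - k)) (assemble v).
  by have /htensorP[] := assemble_htensor v (ltnW kb).
rewrite IHk 1?ltnW// (vdiff_linear f (aP t) (aP u)).
by rewrite addrACA -scalerDr.
Qed.

Lemma assemble_mulrn k (t : tuples k) m : (k <= beta)%N ->
  assemble (t *+ m) = assemble t *+ m.
Proof.
move=> kb; have aD (u v : tuples k) : assemble (u + v) = assemble u + assemble v.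
  by rewrite -[u in LHS]scale1r assemble_linear// scale1r.
elim: m => [|m IHm]; last by rewrite !mulrS aD IHm.
(* For m = 0, additivity at 0 + 0 and cancellation give that 0 is sent to 0. *)
by apply: (addrI (assemble (0 : tuples k))); rewrite -aD !addr0.
Qed.

Lemma contrC_assemble k (t : tuples k.+1) : (k < beta)%N ->
  contrC (assemble t) = assemble (t.1 *+ (beta - k)).
Proof.
move=> kb; rewrite assemble_mulrn 1?ltnW//=.
have -> S T : contrC (S + T) = contrC S + contrC T :> @components _ _ M.
  by rewrite -[S in LHS]scale1r contrC_is_linear scale1r.
have /andP[_ /eqP ->] := ckernel_valP t.2; rewrite addr0.
by apply: contrC_vdiff; exact: assemble_htensor (ltnW kb).
Qed.

(** Contraction recovers [t.1] up to the positive factor [beta - k]; subtracting its vertical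
    derivative then recovers [t.2]. *)
Lemma assemble_inj k : (k <= beta)%N -> injective (@assemble _ _ _ A r omega beta k).
Proof.
elim: k => [|k IHk] kb t u tu; first exact: val_inj.
have tu1 : t.1 = u.1.
  apply: IHk; first exact: ltnW.
  apply: (@components_mulrIn (beta - k)); first by rewrite subn_gt0.
  by rewrite -!assemble_mulrn 1?ltnW// -!contrC_assemble// tu.
case: t u tu1 tu => [t D] [u E] /= -> /addrI DE; congr pair; exact: val_inj.
Qed.

Lemma assemble_surj k S : (k <= beta)%N ->
  S \in htensor_pred A (beta - k) r (omega - (beta - k)) ->
  exists t : tuples k, assemble t = S.
Proof.
elim: k S => [|k IHk] S kb.
  by rewrite subn0 => Sh; exists (HTensor Sh).
rewrite level_succ// => Sh; have bk0 : (0 < beta - k)%N by rewrite subn_gt0.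
(* Here nu = [beta - k], and the tuple represents the only possible S', namely nu^-1 [contrC S]. *)
have [t tE] : exists t : tuples k,
    assemble t = SmoothFun (const_smooth_fun (beta - k)%:R^-1) *: contrC S.
  apply: IHk; first exact: ltnW.
  by apply: rpredZ; have := htensor_contrC Sh; rewrite -degree_succ.
have th := assemble_htensor t (ltnW kb).
(* This remainder is Delta: its contraction is [contrC S] minus nu S', which is 0. *)
have Dh : S - vdiff A (assemble t) \in
    ckernel_pred A (beta - k).-1 r (omega - (beta - k)).+1.
  apply/andP; split.
    rewrite rpredB//; first by rewrite -subnS.
    by apply: htensor_vdiff; rewrite prednK.
  rewrite -scaleN1r addrC contrC_is_linear (contrC_vdiff th) tE.
  by rewrite const_smooth_fun_mulrn// scaleN1r addrC subrr.
by exists (t, CKernel Dh); rewrite /= addrC subrK.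
Qed.

Lemma truncate_mulrn j k (t : tuples (j + k)%N) m :
  truncate (t *+ m) = truncate t *+ m.
Proof.
elim: j t => [//|j IHj] t /=; rewrite -IHj; congr truncate.
by elim: m {IHj} => [|m IHm]; rewrite ?mulrS -?IHm.
Qed.

(** Induction on [j] with [alpha] varying: the contraction applied first yields the smallest factor,
    [alpha.+1], and the remaining ones start from [alpha.+1]. *)
Lemma iter_contrC_assemble j k alpha (t : tuples (j + k)%N) :
  (j + k + alpha = beta)%N ->
  iter j contrC (assemble t) =
  assemble (truncate t *+ \prod_(alpha.+1 <= nu < (alpha + j).+1) nu).
Proof.
elim: j alpha t => [|j IHj] alpha t E.
  by rewrite addn0 big_geq// mulr1n.
have jk : (j + k < beta)%N by rewrite -E addSn addSn ltnS leq_addr.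
case: t => t D; rewrite iterSr (contrC_assemble (t, D) jk) /=.
rewrite (_ : beta - (j + k) = alpha.+1)%N; last by rewrite -E; lia.
rewrite (IHj alpha.+1); last by rewrite -E; lia.
rewrite truncate_mulrn -mulrnA [in RHS]big_ltn; last by rewrite ltnS addnS ltnS leq_addr.
by rewrite addSnnS.
Qed.

End Tuples.
End Levels.

Theorem theorem2 (R : realType) (n : nat) (M : smooth_manifold R n)
    (A : conic_domain M) (r omega alpha beta : nat)
    (lt_alpha_beta : (alpha < beta)%N) (le_beta_omega : (beta <= omega)%N) :
  let tup := tuples A r omega beta in
  let can (k : nat) (t : tup k) := assemble t in
  [/\ (forall gamma : nat, (alpha <= gamma <= beta)%N ->
         exists Phi : {linear tup (beta - gamma)%N ->
                              htensor A gamma r (omega - gamma)%N},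
           bijective Phi /\
           forall t, htensor_val (Phi t) = can (beta - gamma)%N t),
      (forall k : nat, (k < beta - alpha)%N -> forall t : tup k,
         vdiff A (can k t) = can k.+1 (t, 0)),
      (forall k : nat, (k < beta - alpha)%N ->
         forall (t : tup k) (Delta : Ker A r omega (beta - k)%N),
         contrC (can k.+1 (t, Delta)) = can k (t *+ (beta - k)%N)) &
      (forall j k : nat, (j + k)%N = (beta - alpha)%N ->
         forall t : tup (j + k)%N,
         iter j contrC (can (j + k)%N t) =
         can k (truncate t *+ \prod_(alpha.+1 <= nu < (alpha + j).+1) nu))].
Proof.
move=> tup can; split.
- move=> gamma /andP[_ gb]; have kb := leq_subr gamma beta.
  have canP t : can (beta - gamma)%N t \in htensor_pred A gamma r (omega - gamma).
    (* Only the degree and the level are rewritten with [beta - (beta - gamma)]; the tuple length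
       keeps its form. *)
    by rewrite -{2 3}(subKn gb); exact: assemble_htensor.
  pose Phi0 t : htensor A gamma r (omega - gamma) := HTensor (canP t).
  have Phi0_lin : linear Phi0.
    by move=> f t u; apply: val_inj; exact: assemble_linear.
  pose Phi : {linear tup (beta - gamma)%N -> htensor A gamma r (omega - gamma)%N} :=
    HB.pack Phi0 (GRing.isLinear.Build _ _ _ _ Phi0 Phi0_lin).
  exists Phi; split=> //.
  have surj (S : htensor A gamma r (omega - gamma)) :
      exists t : tup (beta - gamma)%N, assemble t = htensor_val S.
    by apply: assemble_surj => //; rewrite (subKn gb); exact: htensor_valP.
  (* The inverse chooses a preimage; injectivity of [assemble] makes it a left inverse too. *)
  exists (fun S => sval (cid (surj S))) => [t|S].
    by apply: (assemble_inj le_beta_omega kb); case: cid.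
  by apply: val_inj; rewrite /= /can; case: cid.
- by move=> k _ t; rewrite /can /= addr0.
- by move=> k kab t D; apply: contrC_assemble => //; lia.
- by move=> j k E t; apply: iter_contrC_assemble; lia.
Qed.
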